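(* Let $G$ be a topological space equipped with subspaces $G_1\subset G_2\subset\cdots$, maps $\Pi_n:G\to G_n$ and a linear order $<$ satisfying Axioms (A), (B), (C) of the context. Then $G$ has large inductive dimension $0$.
   Context: A space $G$ is sequential if whenever $A\subset G$ is not closed there is a convergent sequence $a_n\to x$ with $a_n\in A$ and $x\notin A$. A retraction $\Pi_n:G\to G_n$ is a continuous map restricting to the identity on $G_n$. A space has large inductive dimension $0$ if for any two disjoint closed sets $A,B$ there is a clopen set $U$ with $A\subset U$ and $U\cap B=\emptyset$. Axiom (A). $G$ is a sequential space; $G_1\subset G_2\subset\cdots$ is a nested sequence of closed discrete subspaces of $G$; for each $n\in\{1,2,3,\ldots\}$ the map $\Pi_n:G\to G_n$ is a retraction; the map $\phi:G\to\prod_n G_n$, $\phi(g)=(\Pi_n(g))_n$, is one to one (it is not required to be a topological embedding or a surjection); $\Pi_{n-1}=\Pi_{n-1}\Pi_n$ for all $n\ge 2$; and $\Pi_n(g)\to g$ for each $g\in G$. Axiom (B). $<$ is a linear order on $G$ such that every nonempty closed set $B\subset G$ has a minimal element; $\Pi_1(g)\le\Pi_2(g)\le\cdots\le g$ for every $g\in G$; each $G_n$ is well ordered by $<$; and for each strictly increasing sequence $g_1<g_2<\cdots$ in $G$, either every subsequence of $\{g_n\}$ diverges (fails to converge in $G$), or $\{g_n\}$ converges in $G$ and $\lim g_n=\sup\{g_n\}$ (least upper bound in $(G,<)$). (The topologies of $G$ and $G_n$ are not assumed to be order topologies.) Axiom (C). Let $G_\infty=\bigcup_n G_n$. For $k\in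 G_\infty$ let $N$ be minimal with $k\in G_N$ and define $\mathrm{Blowup}(k)=\Pi_N^{-1}(\Pi_N(k))$. If $k_1<k_2<k_3$ are in $G_\infty$ and $\mathrm{Blowup}(k_3)\subset\mathrm{Blowup}(k_1)$, then $\mathrm{Blowup}(k_2)\subset\mathrm{Blowup}(k_1)$. *)

(* Defs.v *)
From HB Require Import structures.
From mathcomp Require Import all_boot all_order.
From mathcomp Require Import all_classical topology.

Set Implicit Arguments.
Unset Strict Implicit.
Unset Printing Implicit Defensive.

Import Order.TTheory.

Local Open Scope classical_set_scope.

Section topological_notions.
Context {G : topologicalType}.

Definition sequential := forall A : set G, ~ closed A ->
  exists (a : nat -> G) (x : G), [/\ forall n, A (a n), a @ \oo --> x & ~ A x].

Definition discrete_subspace (A : set G) :=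
  forall x, A x -> open ([set x] : set (subspace A)).

(* A map into A is a map f : G -> G with values in A, its continuity being
   taken with respect to the subspace topology on A. *)
Definition retraction (A : set G) (f : G -> G) :=
  [/\ forall g, A (f g), continuous (f : G -> subspace A)
    & forall g, A g -> f g = g].

Definition large_inductive_dim0 := forall A B : set G,
  closed A -> closed B -> A `&` B = set0 ->
  exists U : set G, [/\ clopen U, A `<=` U & U `&` B = set0].

End topological_notions.
Arguments sequential : clear implicits.
Arguments large_inductive_dim0 : clear implicits.

(* No topologicalType structure equipped with an unrelated total order is
   available: POrderedTopological carries a topology and a partial order with no
   compatibility between them, and totality is a field of axiomB. *)
Section axioms.
Context {d : Order.disp_t} {G : POrderedTopological.type d}.

Definition has_least (B : set G) := exists2 m, B m & lbound B m.

Definition well_ordered (A : set G) :=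
  forall B : set G, B `<=` A -> B !=set0 -> has_least B.

Definition convergent (u : nat -> G) := exists l : G, u @ \oo --> l.

(* The sequences G_1, G_2, ... and Pi_1, Pi_2, ... are indexed from 0 :
   Gs n and Pi n stand for G_(n+1) and Pi_(n+1). *)
Variables (Gs : nat -> set G) (Pi : nat -> G -> G).

Record axiomA : Prop := AxiomA {
  axA_sequential : sequential G;
  axA_nested : forall n, Gs n `<=` Gs n.+1;
  axA_closed : forall n, closed (Gs n);
  axA_discrete : forall n, discrete_subspace (Gs n);
  axA_retraction : forall n, retraction (Gs n) (Pi n);
  axA_injective : injective (fun (g : G) (n : nat) => Pi n g);
  axA_comp : forall n, Pi n = Pi n \o Pi n.+1;
  axA_cvg : forall g : G, (fun n => Pi n g) @ \oo --> g
}.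

Record axiomB : Prop := AxiomB {
  axB_total : total (<=%O : rel G);
  axB_closed_least : forall B : set G, closed B -> B !=set0 -> has_least B;
  axB_le_step : forall n (g : G), (Pi n g <= Pi n.+1 g)%O;
  axB_le : forall n (g : G), (Pi n g <= g)%O;
  axB_well_ordered : forall n, well_ordered (Gs n);
  axB_increasing : forall u : nat -> G, (forall n, (u n < u n.+1)%O) ->
    (forall s : nat -> nat, (forall n, s n < s n.+1) -> ~ convergent (u \o s))
    \/ (exists2 l : G, u @ \oo --> l & isLub (range u) l)
}.

Definition Ginfty : set G := \bigcup_n Gs n.

Definition first_index (k : G) (N : nat) :=
  Gs N k /\ forall m, Gs m k -> N <= m.

(* For k in Ginfty the index N below is unique. *)
Definition Blowup (k : G) : set G :=
  [set g | exists2 N, first_index k N & (Pi N @^-1` [set Pi N k]) g].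

Definition axiomC := forall k1 k2 k3 : G,
  Ginfty k1 -> Ginfty k2 -> Ginfty k3 -> (k1 < k2)%O -> (k2 < k3)%O ->
  Blowup k3 `<=` Blowup k1 -> Blowup k2 `<=` Blowup k1.

End axioms.

(* Main.v *)
(* The fibres of the Pi n form a tree of clopen sets.  By axiom (C) the fibre of
   Pi n through a point k new in G_n is order convex with least element k.  If
   g is not in G_infty, the fibres through g form a base at g: points of a
   closed set C lying in smaller and smaller fibres either interleave with Pi n g below
   g, and converge to g, or decrease to g, and closed sets have least elements.
   At a node g in G_infty this fails, but if g is not in the closed set C, the
   children of g whose blowups meet C are well ordered, hence cannot accumulate
   at g: an infinite family of them would contain an increasing sequence, and an
   increasing sequence in distinct blowups can only converge to its supremum.
   So one may descend the tree until a fibre avoids A or B, and colour it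
   accordingly, fibres that avoid both inheriting the colour of their parent. *)
Require Import Defs.
From HB Require Import structures.
From mathcomp Require Import all_boot all_order.
From mathcomp Require Import all_classical topology.

Set Implicit Arguments.
Unset Strict Implicit.
Unset Printing Implicit Defensive.

Import Order.TTheory.

Local Open Scope classical_set_scope.

(** * Convergent sequences in sequential spaces *)

Section sequences.
Context {T : topologicalType}.
Implicit Types (u : nat -> T) (l : T) (O : set T).

Lemma cvg_eventually u l O : u @ \oo --> l -> open O -> O l ->
  exists N, forall n, N <= n -> O (u n).
Proof.
move=> ul Oo Ol; have [N _ NO] := ul _ (open_nbhs_nbhs (conj Oo Ol)).
by exists N => n Nn; exact: NO.
Qed.

Lemma cvg_subsequence u l (s : nat -> nat) : u @ \oo --> l ->
  (forall n, n <= s n) -> (u \o s) @ \oo --> l.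
Proof.
move=> ul sn A /ul[N _ NA]; exists N => // n /= Nn.
by apply: NA => /=; exact: leq_trans (sn n).
Qed.

Lemma sequential_open O : sequential T ->
  (forall u l, u @ \oo --> l -> O l -> exists n, O (u n)) -> open O.
Proof.
move=> seqT HO; rewrite -closedC; apply: contrapT.
by move=> /seqT[u [l [uO ul /contrapT Ol]]]; have [n /(uO n)] := HO _ _ ul Ol.
Qed.

End sequences.

Lemma leq_increasing (s : nat -> nat) : (forall n, s n < s n.+1) ->
  forall n, n <= s n.
Proof. by move=> si; elim=> // n IH; exact: leq_ltn_trans (si n). Qed.

(** * Projections and the tree of their fibres *)

Section tree.
Context {d : Order.disp_t} {G : POrderedTopological.type d}.
Context (Gs : nat -> set G) (Pi : nat -> G -> G).
Context (HA : axiomA Gs Pi) (HB : axiomB Gs Pi) (HC : axiomC Gs Pi).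
Implicit Types (g x y z k : G) (C : set G) (u : nat -> G).

Let seqG := axA_sequential HA.

Lemma not_le_lt x y : ~ (x <= y)%O -> (y < x)%O.
Proof.
move=> nxy; have /orP[//|yx] := axB_total HB x y.
by rewrite lt_neqAle yx andbT; apply/eqP => e; apply: nxy; rewrite e.
Qed.

Lemma lt_not_le x y : (x < y)%O -> ~ (y <= x)%O.
Proof. by move=> xy yx; have := le_lt_trans yx xy; rewrite ltxx. Qed.

Lemma Gs_mono m n : m <= n -> Gs m `<=` Gs n.
Proof.
by move=> /subnK <-; elim: (n - m) => // p IH x /IH; exact: (axA_nested HA).
Qed.

Lemma Pi_Gs n x : Gs n (Pi n x).
Proof. by have [] := axA_retraction HA n. Qed.

Lemma Pi_id n x : Gs n x -> Pi n x = x.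
Proof. by have [_ _] := axA_retraction HA n; apply. Qed.

Lemma Pi_comp m n x : m <= n -> Pi m (Pi n x) = Pi m x.
Proof.
move=> /subnK <-; elim: (n - m) x => [|p IH] x.
  by rewrite Pi_id//; exact: Pi_Gs.
by rewrite -IH -[in RHS]IH [in RHS](axA_comp HA (p + m)).
Qed.

Lemma Pi_inj x y : (forall n, Pi n x = Pi n y) -> x = y.
Proof. by move=> xy; apply: (axA_injective HA); apply/funext. Qed.

Lemma Pi_eqW m n x y : m <= n -> Pi n x = Pi n y -> Pi m x = Pi m y.
Proof. by move=> mn e; rewrite -(Pi_comp x mn) e Pi_comp. Qed.

Lemma Pi_le m n x : m <= n -> (Pi m x <= Pi n x)%O.
Proof.
move=> /subnK <-; elim: (n - m) => // p IH.
by rewrite addSn; exact: le_trans IH (axB_le_step HB _ _).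
Qed.

Lemma Pi_stable n x : (forall m, n <= m -> Pi m x = Pi n x) -> Pi n x = x.
Proof.
move=> st; apply: Pi_inj => m; have [mn|/ltnW nm] := leqP m n.
  exact: Pi_comp.
by rewrite st// Pi_id//; apply: Gs_mono nm _ _; exact: Pi_Gs.
Qed.

Lemma open_fiber m x : open [set y | Pi m y = Pi m x].
Proof.
have [_ /continuousP cPi _] := axA_retraction HA m.
exact: cPi _ (axA_discrete HA (Pi_Gs m x)).
Qed.

Lemma cvg_Pi u l m : u @ \oo --> l ->
  exists N, forall n, N <= n -> Pi m (u n) = Pi m l.
Proof. by move=> ul; exact: (cvg_eventually ul (open_fiber m l)). Qed.

(** Projections are locally constant and jointly injective, which replaces a Hausdorff
    hypothesis. *)
Lemma limit_unique u x y : u @ \oo --> x -> u @ \oo --> y -> x = y.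
Proof.
move=> ux uy; apply: Pi_inj => m.
have [M uM] := cvg_Pi m ux; have [N uN] := cvg_Pi m uy.
by rewrite -(uM (M + N)) ?leq_addr// uN ?leq_addl.
Qed.

(* The axiom on increasing sequences only asks for one convergent subsequence. *)
Lemma increasing_lub u l (s : nat -> nat) : (forall n, (u n < u n.+1)%O) ->
  (forall n, s n < s n.+1) -> (u \o s) @ \oo --> l ->
  u @ \oo --> l /\ isLub (range u) l.
Proof.
move=> ui si usl; have [div|[l' ul' lub]] := axB_increasing HB ui.
  by case: (div s si); exists l.
have /(limit_unique usl) -> // := cvg_subsequence ul' (leq_increasing si).
Qed.

(** If [Pi n y] stabilises, its value is [y]. Otherwise a strictly increasing subsequence converges
    to [y], which axiom (B) makes its supremum, so [x] cannot bound it. *)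
Lemma Pi_sup x y : (x < y)%O -> exists n, (x < Pi n y)%O.
Proof.
move=> xy; apply: contrapT => /forallNP nx.
have le_x n : (Pi n y <= x)%O.
  by apply: contrapT => /not_le_lt; exact: nx.
have /choice[h hP] n : exists m, n < m /\ (Pi n y < Pi m y)%O.
  apply: contrapT => /forallNP nm.
  have /Pi_stable e : forall m, n <= m -> Pi m y = Pi n y.
    move=> m; rewrite leq_eqVlt => /predU1P[->//|nlm].
    apply/eqP; rewrite eq_le (Pi_le y (ltnW nlm)) andbT.
    by apply: contrapT => /not_le_lt lt_nm; apply: (nm m).
  by have := lt_not_le xy; rewrite -e; apply.
pose s n := iter n h 0.
have si n : s n < s n.+1 by have [] := hP (s n).
have ui n : (Pi (s n) y < Pi (s n.+1) y)%O by have [] := hP (s n).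
have uy := cvg_subsequence (axA_cvg HA (g := y)) (leq_increasing si).
have [_ [_ lub]] := increasing_lub (s := id) ui (fun n => leqnn n.+1) uy.
by apply: (lt_not_le xy); apply: lub => _ [n _ <-].
Qed.

Lemma Pi_sup_eventually x y m : (x < y)%O -> exists2 n, m <= n & (x < Pi n y)%O.
Proof.
move=> /Pi_sup[n xn]; exists (m + n); first exact: leq_addr.
by apply: lt_le_trans xn _; apply: Pi_le; exact: leq_addl.
Qed.

(** * Order convexity of the fibres *)

Lemma first_index_ex k : Ginfty Gs k -> exists n, first_index Gs k n.
Proof.
move=> [n _ Gnk]; have exP : exists m, `[< Gs m k >] by exists n; exact/asboolP.
exists (ex_minn exP); case: ex_minnP => M /asboolP GM minM.
by split => // m Gm; apply: minM; exact/asboolP.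
Qed.

(** Axiom (C) speaks only of points of [Ginfty], so [z] and [x] are replaced by projections with
    [k < Pi q z < Pi p x]. *)
Lemma Blowup_convex k n x z : first_index Gs k n -> Pi n x = k ->
  (k <= z)%O -> (z <= x)%O -> Pi n z = k.
Proof.
move=> fk xk; have [Gnk _] := fk; rewrite le_eqVlt => /predU1P[<- _|kz].
  exact: Pi_id.
rewrite le_eqVlt => /predU1P[->//|zx].
have [p np zk3] := Pi_sup_eventually n zx.
have [q nq kk2] := Pi_sup_eventually n kz.
have Ginf r y : Ginfty Gs (Pi r y) by exists r => //; exact: Pi_Gs.
have k2k3 : (Pi q z < Pi p x)%O by apply: le_lt_trans zk3; exact: (axB_le HB).
have Gk : Ginfty Gs k by exists n.
have k3k : Pi n (Pi p x) = k by rewrite Pi_comp.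
(* [Pi p x] first appears at a level [M >= n]: otherwise [Pi n] would fix it and it would equal
   [k]. *)
have sub : Blowup Gs Pi (Pi p x) `<=` Blowup Gs Pi k.
  move=> w [M [GM _] /= wM]; exists n => //=.
  have [nM|/ltnW Mn] := leqP n M; first by rewrite (Pi_eqW nM wM) k3k Pi_id.
  have := lt_trans kk2 k2k3; rewrite -k3k Pi_id ?ltxx//.
  exact: Gs_mono Mn _ GM.
have [M fM] := first_index_ex (Ginf q z).
have [|n' fn'] := HC Gk (Ginf q z) (Ginf p x) kk2 k2k3 sub (t := Pi q z).
  by exists M.
have -> : n' = n.
  case: fn' => Gn' minn'; case: fk => _ minn; apply/eqP.
  by rewrite eqn_leq minn// minn'.
by rewrite /= Pi_comp// => ->; exact: Pi_id.
Qed.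

Lemma first_index_Pi n x : ~ Gs n (Pi n.+1 x) ->
  first_index Gs (Pi n.+1 x) n.+1.
Proof.
move=> nG; split; first exact: Pi_Gs.
by move=> m Gm; rewrite ltnNge; apply/negP => mn; apply: nG; exact: Gs_mono Gm.
Qed.

Lemma Pi_convex n x y z : ~ Gs n (Pi n.+1 x) -> Pi n.+1 y = Pi n.+1 x ->
  (Pi n.+1 x <= z)%O -> (z <= y)%O -> Pi n.+1 z = Pi n.+1 x.
Proof. by move=> /first_index_Pi; exact: Blowup_convex. Qed.

(** * Closed sets meeting every fibre through a point *)

Lemma limit_from_below g C : closed C ->
  (forall m, exists x, [/\ C x, Pi m x = Pi m g & (x < g)%O]) -> C g.
Proof.
move=> clC HCg.
have Pi_lt m : (Pi m g < g)%O.
  have [x [_ <- xg]] := HCg m; exact: le_lt_trans (axB_le HB _ _) xg.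
have /choice[h hP] m : exists pc : nat * G,
    [/\ C pc.2, (Pi m g < pc.2)%O, (pc.2 < Pi pc.1 g)%O & m < pc.1].
  have [p pm] := Pi_sup (Pi_lt m); have [x [Cx xp xg]] := HCg p.
  have [q mq xq] := Pi_sup_eventually m.+1 xg; exists (q, x); split => //=.
  by apply: lt_le_trans pm _; rewrite -xp; exact: (axB_le HB).
(* The increasing [u] alternates projections of [g] (even terms) with points of [C] (odd terms). By
   axiom (B) convergence of the even terms to [g] extends to all of [u], hence to the odd terms. *)
pose s n := iter n (fun m => (h m).1) 0.
pose u n := if odd n then (h (s n./2)).2 else Pi (s n./2) g.
have si n : s n < s n.+1 by have [] := hP (s n).
have ui n : (u n < u n.+1)%O.
  rewrite /u /= uphalf_half; have [_ lt1 lt2 _] := hP (s n./2).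
  by case: (odd n) => /=; rewrite ?add0n ?add1n.
have ue : u \o double = (fun n => Pi n g) \o s.
  by apply/funext => n; rewrite /= /u odd_double doubleK.
have [||ug _] := increasing_lub (s := double) (l := g) ui.
- by move=> n; rewrite ltn_double.
- rewrite ue; apply: cvg_subsequence (axA_cvg HA (g := g)) _.
  exact: leq_increasing.
have vg : (u \o (fun n => n.*2.+1)) @ \oo --> g.
  by apply: cvg_subsequence ug _ => n; rewrite leqW// -addnn leq_addr.
apply: closed_cvg clC _ _ vg; apply: nearW => n /=.
by rewrite /u /= odd_double /=; have [] := hP (s n.*2.+1./2).
Qed.

(** The range of [u] has no least element, so it is not closed and some sequence in it tends to a
    point [l] outside it. That sequence eventually avoids any finite set of terms, so [l] has the
    projections of [g]. *)
Lemma decreasing_limit u g C : closed C -> (forall n, C (u n)) ->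
  (forall n, (u n.+1 < u n)%O) ->
  (forall m, exists N, forall n, N <= n -> Pi m (u n) = Pi m g) -> C g.
Proof.
move=> clC Cu ud ug; apply: contrapT => nCg.
have : ~ closed (range u).
  move=> /(axB_closed_least HB)[|_ [n _ <-] lb]; first by exists (u 0), 0.
  by apply: lt_not_le (ud n) _; apply: lb; exists n.+1.
move=> /seqG[w [l [wu wl nul]]].
have Cl : C l.
  by apply: closed_cvg clC _ _ wl; apply: nearW => n; have [i _ <-] := wu n.
have [m lm] : exists m, Pi m l <> Pi m g.
  by apply/existsNP => /Pi_inj lg; apply: nCg; rewrite -lg.
have [N uN] := ug m.
have avoid p : exists M, forall n, M <= n -> forall i, i < p -> w n <> u i.
  elim: p => [|p [M IH]]; first by exists 0.
  have [r lr] : exists r, Pi r (u p) <> Pi r l.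
    by apply/existsNP => /Pi_inj e; apply: nul; exists p.
  have [M' wM'] := cvg_Pi r wl; exists (M + M') => n nM i.
  rewrite ltnS leq_eqVlt => /predU1P[->|ip]; last first.
    by apply: IH ip; apply: leq_trans nM; exact: leq_addr.
  by move=> e; apply: lr; rewrite -e wM'//; apply: leq_trans nM; exact: leq_addl.
have [M wM] := avoid N; have [M' wM'] := cvg_Pi m wl.
have [i _ wi] := wu (M + M'); have [Ni|iN] := leqP N i.
  by apply: lm; rewrite -(wM' (M + M')) ?leq_addl// -wi uN.
by apply: (wM (M + M') _ i) => //; exact: leq_addr.
Qed.

Lemma limit_from_above g C m0 : ~ Ginfty Gs g -> closed C ->
  (forall x, C x -> Pi m0 x = Pi m0 g -> (g < x)%O) ->
  (forall m, exists2 x, C x & Pi m x = Pi m g) -> C g.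
Proof.
move=> nGg clC gt_g HCg.
have new m : exists2 n, m <= n & ~ Gs n (Pi n.+1 g).
  apply: contrapT => /forall2NP old; apply: nGg; exists m => //.
  suff /Pi_stable <- : forall n, m <= n -> Pi n g = Pi m g by exact: Pi_Gs.
  move=> n /subnK <-; elim: (n - m) => // p <-.
  have [/negP|/contrapT] := old (p + m); first by rewrite leq_addl.
  by rewrite addSn => /Pi_id <-; rewrite Pi_comp.
have step m c : (g < c)%O -> exists c', [/\ C c', (g < c')%O,
    Pi m c' = Pi m g & (c' < c)%O].
  move=> gc; have [p cp] : exists p, Pi p c <> Pi p g.
    by apply/existsNP => /Pi_inj e; rewrite e ltxx in gc.
  (* Beyond [m0] the point [c'] exceeds [g]; beyond [m] it is close enough to [g]; beyond [p] the
     fibre excludes [c] and, being convex, stays below it. *)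
  have [n mn nG] := new (m0 + m + p).
  have [c' Cc' c'n] := HCg n.+1.
  have le_n r : r <= m0 + m + p -> Pi r c' = Pi r g.
    by move=> rn; apply: Pi_eqW c'n; apply: leq_trans rn (leqW mn).
  have gc' : (g < c')%O by apply: gt_g Cc' _; rewrite le_n// -addnA leq_addr.
  exists c'; split => //; first by rewrite le_n// addnAC leq_addl.
  apply: not_le_lt => cc'; apply: cp.
  have cg := Pi_convex nG c'n (ltW (le_lt_trans (axB_le HB _ _) gc)) cc'.
  by apply: Pi_eqW cg; apply: leqW; apply: leq_trans mn; exact: leq_addl.
have [c0 Cc0 /(gt_g _ Cc0) gc0] := HCg m0.
have /choice[f fP] (mc : nat * G) : exists c', (g < mc.2)%O ->
    [/\ C c', (g < c')%O, Pi mc.1 c' = Pi mc.1 g & (c' < mc.2)%O].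
  have [gc|ngc] := pselect (g < mc.2)%O; last by exists g.
  by have [c' P] := step mc.1 mc.2 gc; exists c'.
pose u := fix u n := if n is n'.+1 then f (n', u n') else c0.
have gu n : (g < u n)%O /\ C (u n).
  by elim: n => // n [gn _]; have [] := fP (n, u n) gn.
apply: (@decreasing_limit u) => // n; first by have [] := gu n.
  by have [gn _] := gu n; have [] := fP (n, u n) gn.
exists n.+1 => -[//|p]; rewrite ltnS => np; have [gp _] := gu p.
by have [_ _ /(Pi_eqW np)] := fP (p, u p) gp.
Qed.

Lemma fiber_base g C : ~ Ginfty Gs g -> closed C ->
  (forall m, exists2 x, C x & Pi m x = Pi m g) -> C g.
Proof.
move=> nGg clC HCg.
have [below|/existsNP[m0 nbelow]] := pselect (forall m, exists x,
    [/\ C x, Pi m x = Pi m g & (x < g)%O]); first exact: limit_from_below below.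
have [//|nCg] := pselect (C g).
apply: (@limit_from_above _ _ m0) => // x Cx xg.
apply: not_le_lt; rewrite le_eqVlt => /predU1P[e|xlt].
  by apply: nCg; rewrite -e.
by apply: nbelow; exists x.
Qed.

(** * Children of a node and the points leaving through them *)

Definition exits g m x := Pi m x = Pi m g /\ Pi m.+1 x <> Pi m.+1 g.

Lemma exits_ex g x n : Pi n x = Pi n g -> x <> g ->
  exists2 m, n <= m & exits g m x.
Proof.
move=> xgn xg; have exP : exists m, `[< Pi m x <> Pi m g >].
  have /existsNP[m xm] : ~ forall m, Pi m x = Pi m g by move=> /Pi_inj.
  by exists m; exact/asboolP.
case: (ex_minnP exP) => m /asboolP xgm minm.
have nm : n < m by rewrite ltnNge; apply/negP => /Pi_eqW/(_ xgn).
exists m.-1; first by case: m nm {xgm minm}.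
case: m nm xgm minm => // m _ xgm minm; split => //=.
by apply: contrapT => nxg; have := minm m (asboolT nxg); rewrite ltnn.
Qed.

Lemma exits_unique g m n x : exits g m x -> exits g n x -> m = n.
Proof.
move=> [xm nxm] [xn nxn]; apply/eqP; rewrite eqn_leq.
by apply/andP; split; rewrite leqNgt; apply/negP => /Pi_eqW; auto.
Qed.

Lemma exits_eq g m x y : Pi m.+1 y = Pi m.+1 x -> exits g m x -> exits g m y.
Proof. by move=> e [xm xm1]; split; rewrite ?e// (Pi_eqW _ e). Qed.

Section below_node.
Context (g : G) (N : nat) (GNg : Gs N g).

Lemma Pi_node m : N <= m -> Pi m g = g.
Proof. by move=> Nm; apply: Pi_id; exact: Gs_mono Nm _ GNg. Qed.

(** Otherwise [Pi m] would fix [Pi m.+1 x] and force it to equal [g]. Newness is what makes the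
    fibre of a child convex. *)
Lemma exits_new m x : N <= m -> exits g m x -> ~ Gs m (Pi m.+1 x).
Proof.
move=> Nm [xm xm1] /Pi_id; rewrite Pi_comp// xm Pi_node// => e.
by apply: xm1; rewrite -e Pi_node// leqW.
Qed.

(** If [y <= x], convexity would put [y] in the child containing [x], making the two children
    equal. *)
Lemma exits_lt m n x y : N <= m -> exits g m x -> exits g n y ->
  (Pi m.+1 x < Pi n.+1 y)%O -> (x < y)%O.
Proof.
move=> Nm ex ey xy; apply: not_le_lt => yx.
have xy' : (Pi m.+1 x <= y)%O := le_trans (ltW xy) (axB_le HB n.+1 y).
have e := Pi_convex (exits_new Nm ex) (erefl _) xy' yx.
by move: xy; rewrite -(exits_unique (exits_eq e ex) ey) e ltxx.
Qed.

(* Any family of children of g whose blowups meet C has a least element, because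
   the part of C lying in those blowups is closed. *)
Lemma exits_least C (I : set nat) (e : nat -> nat) (c : nat -> G) :
  closed C -> ~ C g -> I !=set0 ->
  (forall i, [/\ C (c i), N <= e i & exits g (e i) (c i)]) ->
  exists2 i, I i & forall j, I j -> (Pi (e i).+1 (c i) <= Pi (e j).+1 (c j))%O.
Proof.
move=> clC nCg [i0 Ii0] cP.
pose E := [set x | C x /\ exists2 i, I i & Pi (e i).+1 x = Pi (e i).+1 (c i)].
have clE : closed E.
  move=> x Ex; have Cx : C x.
    by apply: clC => D /Ex[w [[Cw _] Dw]]; exists w.
  have /existsNP[m xm] : ~ forall m, Pi m x = Pi m g.
    by move=> /Pi_inj xg; apply: nCg; rewrite -xg.
  (* At level [m] the point [x] has left the branch of [g], so a point [w] of [E] in its fibre has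
     left too, and [x] lies in the same child. *)
  have [w [[_ [i Ii wi]] /= wx]] :=
    Ex _ (open_nbhs_nbhs (conj (open_fiber m x) erefl)).
  split => //; exists i => //; have [im|mi] := ltnP (e i) m.
    by rewrite -wi; apply/esym; exact: Pi_eqW wx.
  exfalso; apply: xm; have [_ _ [ci _]] := cP i.
  by rewrite -wx (Pi_eqW (leqW mi) wi); exact: Pi_eqW ci.
have [|l [Cl [i Ii li]] lb] := axB_closed_least HB clE.
  by exists (c i0); split; [have [] := cP i0 | exists i0].
exists i => // j Ij; have [Ci Ni ei] := cP i; have [Cj Nj ej] := cP j.
apply: contrapT => /not_le_lt ji; rewrite -li in ji.
apply: (lt_not_le (exits_lt Nj ej (exits_eq li ei) ji)).
by apply: lb; split => //; exists j.
Qed.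

(** Otherwise all late terms lie in children meeting [C], and repeatedly taking least children
    extracts an increasing subsequence. Its limit [g] is its supremum, yet its terms project to [g]
    and exceed it from the second on. *)
Lemma children_avoid C u : closed C -> ~ C g -> u @ \oo --> g ->
  exists2 i, Pi N (u i) = g & forall m, exits g m (u i) ->
    forall x, Pi m.+1 x = Pi m.+1 (u i) -> ~ C x.
Proof.
move=> clC nCg ug; apply: contrapT => nex.
have [M uM] := cvg_Pi N ug; rewrite Pi_node// in uM.
pose v n := u (M + n).
have vg : v @ \oo --> g.
  by apply: cvg_subsequence ug _ => n; exact: leq_addl.
have vN n : Pi N (v n) = g by apply: uM; exact: leq_addr.
have /choice[ec ecP] n : exists ec : nat * G,
    [/\ C ec.2, exits g ec.1 (v n) & Pi ec.1.+1 ec.2 = Pi ec.1.+1 (v n)].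
  apply: contrapT => /forallNP nec; apply: nex; exists (M + n); first exact: vN.
  by move=> m em x xm Cx; apply: (nec (m, x)).
pose e n := (ec n).1; pose c n := (ec n).2.
have ev n : exits g (e n) (v n) by have [] := ecP n.
have cv n : Pi (e n).+1 (c n) = Pi (e n).+1 (v n) by have [] := ecP n.
have exN n : N <= e n.
  rewrite leqNgt; apply/negP => eN; have [_] := ev n; apply.
  by apply: Pi_eqW eN _; rewrite vN Pi_node.
have cP n : [/\ C (c n), N <= e n & exits g (e n) (c n)].
  by split => //; [have [] := ecP n | exact: exits_eq (ev n)].
(* [h n] has the least child among later indices of larger exit level; these exist because [v] tends
   to [g]. *)
have /choice[h hP] n : exists i, [/\ n < i, e n < e i & forall j, n < j ->
    e n < e j -> (Pi (e i).+1 (v i) <= Pi (e j).+1 (v j))%O].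
  have [|i [ni ei] lb] :=
    @exits_least C [set i | n < i /\ e n < e i] e c clC nCg _ cP.
    have [p vp] := cvg_Pi (e n).+1 vg; exists (p + n.+1); split.
      exact: leq_addl.
    rewrite ltnNge; apply/negP => le_e; have [_] := ev (p + n.+1); apply.
    by apply: Pi_eqW (vp _ (leq_addr _ _)).
  by exists i; split => // j nj ej; rewrite -!cv; exact: lb.
(* With [n.+1] every [s n] is a value of [h], so minimality is available for each term. *)
pose s n := iter n.+1 h 0.
have si n : s n < s n.+1 by have [] := hP (s n).
have esi n : e (s n) < e (s n.+1) by have [] := hP (s n).
have vi n : (v (s n) < v (s n.+1))%O.
  apply: exits_lt (ev _) (ev _) _ => //; rewrite lt_neqAle; apply/andP; split.
    apply/eqP => eqv; have [_] := ev (s n); apply.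
    have [vg' _] := ev (s n.+1); rewrite -(Pi_eqW (esi n) vg').
    by rewrite -[LHS](Pi_comp _ (leqnn _)) eqv Pi_comp// leqW.
  have [n1 e1 lb] := hP (iter n h 0); have [n2 e2 _] := hP (s n).
  by apply: lb; [exact: ltn_trans n2 | exact: ltn_trans e2].
have [|_ [ub _]] := increasing_lub (s := id) vi (fun n => leqnn n.+1) (l := g).
  by apply: cvg_subsequence vg _; exact: leq_increasing.
have : (g < v (s 1))%O.
  by apply: le_lt_trans (vi 0); rewrite -(vN (s 0)); exact: (axB_le HB).
by move=> /lt_not_le; apply; apply: ub; exists 1.
Qed.

End below_node.

(** * The separating clopen set *)

Definition meets C m g := exists2 x, C x & Pi m x = Pi m g.

Lemma meets_eq C m x y : Pi m x = Pi m y -> meets C m x -> meets C m y.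
Proof. by move=> e [z Cz zx]; exists z => //; rewrite zx. Qed.

Lemma meets_mem C m x : C x -> meets C m x.
Proof. by exists x. Qed.

Section separation.
Context (A B : set G) (clA : closed A) (clB : closed B) (AB0 : A `&` B = set0).

Let disj x : A x -> B x -> False.
Proof. by move=> Ax Bx; have : (A `&` B) x by []; rewrite AB0. Qed.

Definition mixed m g := meets A m g /\ meets B m g.

Definition first_unmixed m g := (forall i, i < m -> mixed i g) /\ ~ mixed m g.

(* A fibre that is the first on its branch to avoid A or B goes to the side of
   the set it meets; if it avoids both, it follows its parent node. *)
Definition separator : set G := [set g |
  (exists m, [/\ forall i, i < m -> mixed i g, ~ meets B m g
    & meets A m g \/ ~ B (Pi m.-1 g)])
  \/ (forall m, mixed m g) /\ ~ B g].

Lemma mixed_eq m x y : Pi m x = Pi m y -> mixed m x -> mixed m y.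
Proof. by move=> e [/(meets_eq e) ? /(meets_eq e)]. Qed.

Lemma first_unmixed_ex g :
  ~ (forall m, mixed m g) -> exists m, first_unmixed m g.
Proof.
move=> /existsNP[m gm]; have exP : exists m, `[< ~ mixed m g >].
  by exists m; exact/asboolP.
exists (ex_minn exP); case: ex_minnP => n /asboolP gn minn; split => // i.
by rewrite ltnNge; apply: contraNP => /asboolP; exact: minn.
Qed.

Lemma first_unmixed_eq m x y : Pi m x = Pi m y -> first_unmixed m x ->
  first_unmixed m y.
Proof.
move=> e [xi xm]; split => [i im|/(mixed_eq (esym e))//].
by apply: mixed_eq (xi i im); apply: Pi_eqW e; exact: ltnW.
Qed.

(** Levels below [m] are mixed and [m] is not, so [m] is the only possible witness in [separator].
    For [m = 0] the fibre counts as its own parent. *)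
Lemma separatorE m g : first_unmixed m g ->
  separator g <-> ~ meets B m g /\ (meets A m g \/ ~ B (Pi m.-1 g)).
Proof.
move=> [gi gm]; split => [[[n [gi' nB nA]]|[/(_ m)//]]|[? ?]]; last first.
  by left; exists m.
suff -> : m = n by [].
apply/eqP; rewrite eqn_leq; apply/andP; split; rewrite leqNgt; apply/negP.
  by move=> /gi[].
by move=> /gi'.
Qed.

Lemma sub_separator : A `<=` separator.
Proof.
move=> a Aa; have [am|/first_unmixed_ex[m am]] := pselect (forall m, mixed m a).
  by right; split => //; exact: disj.
apply/(separatorE am); have aA := meets_mem m Aa.
by split; [move=> aB; case: am => _; apply | left].
Qed.

Lemma separator_disj : separator `&` B = set0.
Proof.
apply/eqP; apply: contrapT => /negP/set0P[b [[[m [_ nB _]]|[_ nB]] Bb]] //.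
by apply: nB; exact: meets_mem.
Qed.

(** One index is enough: with sequentiality it makes both [separator] and its complement open. *)
Lemma separator_cvg u x : u @ \oo --> x ->
  exists i, separator (u i) <-> separator x.
Proof.
move=> ux; have [xm|/first_unmixed_ex[m xm]] :=
  pselect (forall m, mixed m x); last first.
  have [n /(_ n (leqnn n)) un] := cvg_Pi m ux; exists n.
  have um := first_unmixed_eq (esym un) xm.
  rewrite (propext (separatorE um)) (propext (separatorE xm)).
  have -> : Pi m.-1 (u n) = Pi m.-1 x := Pi_eqW (leq_pred m) un.
  have E C : meets C m (u n) <-> meets C m x.
    by split; apply: meets_eq; rewrite un.
  by rewrite (propext (E A)) (propext (E B)).
(* All fibres of [x] meet both [A] and [B], so outside [Ginfty] the point would lie in both. *)
have [N _ GNx] : Ginfty Gs x.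
  apply: contrapT => nGx; apply: (@disj x); apply: fiber_base => // m.
    by have [] := xm m.
  by have [] := xm m.
have sepx : separator x <-> ~ B x.
  split=> [[[m [_ nB _]] _|[]//]|nB]; last by right.
  by apply: nB; have [] := xm m.
(* [C] is the set opposite to the side of [x]. A child of [x] avoiding [C] is a first unmixed fibre
   and takes the side of [x], directly or through its parent [x]. *)
pose C : set G := if `[< B x >] then A else B.
have clC : closed C by rewrite /C; case: ifP.
have nCx : ~ C x by rewrite /C; case: asboolP => // Bx /disj; exact.
have [i uN ui] := children_avoid GNx clC nCx ux; exists i.
have [->//|uix] := pselect (u i = x).
have uN' : Pi N (u i) = Pi N x by rewrite (Pi_id GNx).
have [m Nm em] := exits_ex uN' uix.
have avoidC : ~ meets C m.+1 (u i) by move=> [y Cy /(ui m em)]; exact.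
have um : first_unmixed m.+1 (u i).
  split => [j jm|[mA mB]]; last by move: avoidC; rewrite /C; case: ifP.
  by apply: mixed_eq (xm j); have [xu _] := em; apply/esym; apply: Pi_eqW xu.
rewrite (propext (separatorE um)) (propext sepx) /=.
have -> : Pi m (u i) = x by have [-> _] := em; exact: Pi_node GNx _ Nm.
move: avoidC; rewrite /C; case: asboolP => Bx nm; split.
- by case=> _ [].
- by [].
- by [].
- by move=> nB; split => //; right.
Qed.

Lemma separator_clopen : clopen separator.
Proof.
split.
  apply: sequential_open seqG _ => u x /separator_cvg[i [_ ui]] /ui.
  by exists i.
rewrite -openC; apply: sequential_open seqG _ => u x /separator_cvg[i [ui _]] nx.
by exists i => /ui.
Qed.

End separation.
End tree.

Theorem theorem2p15 (d : Order.disp_t) (G : POrderedTopological.type d)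
    (Gs : nat -> set G) (Pi : nat -> G -> G) :
  axiomA Gs Pi -> axiomB Gs Pi -> axiomC Gs Pi -> large_inductive_dim0 G.
Proof.
move=> HA HB HC A B clA clB AB0; exists (separator Pi A B); split.
- exact: separator_clopen HA HB HC _ _ clA clB AB0.
- exact: sub_separator.
- exact: separator_disj.
Qed.
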